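(* Let $(X,S,\tau)$ be a singular pair, and let $U_{nc}^{fh}=U_{nc}^{fh}(X,S,\tau)$ be its universal group with the maps $\pi_f,\pi_h:X\times X\to U_{nc}^{fh}$. Then: 1. The pair of maps $\pi_f,\pi_h:X\times X\to U_{nc}^{fh}$ is a non commutative 2-cocycle pair. 2. If $H$ is a group and $f,h:X\times X\to H$ is a non commutative 2-cocycle pair, then there exists a unique group homomorphism $\rho:U_{nc}^{fh}\to H$ such that $f=\rho\circ\pi_f$ and $h=\rho\circ\pi_h$.
   Context: Notation: for $T:X\times X\to X\times X$ write $T(x,y)=(T^1(x,y),T^2(x,y))$. $T$ is left invertible if for any $x,z$ there is a unique $y$ with $T^1(x,y)=z$; right invertible if for any $y,w$ there is a unique $x$ with $T^2(x,y)=w$. A biquandle is a pair $(X,S)$, where $S:X\times X\to X\times X$ is a bijection, left and right invertible, satisfying $(\mathrm{Id}\times S)(S\times \mathrm{Id})(\mathrm{Id}\times S)=(S\times \mathrm{Id})(\mathrm{Id}\times S)(S\times \mathrm{Id})$, and such that there is a bijection $s:X\to X$ with $\{(x,y):S(x,y)=(x,y)\}=\{(x,s(x)):x\in X\}$. Given a biquandle $(X,S)$ and a bijective, left and right invertible $\tau:X\times X\to X\times X$, $(X,S,\tau)$ is a singular pair if $\tau\circ S=S\circ\tau$, $(S\times 1)(1\times S)(\tau\times 1)=(1\times \tau)(S\times 1)(1\times S)$ and $(1\times S)(S\times 1)(1\times \tau)=(\tau\times 1)(1\times S)(S\times 1)$. For a group $H$ (not necessarily commutative) and maps $f,h:X\times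 X\to H$, the pair $(f,h)$ is a non commutative 2-cocycle pair if for all $x,y,z\in X$: (f1) $f(x,y)\,f(S^2(x,y),z)=f(x,S^1(y,z))\,f(S^2(x,S^1(y,z)),S^2(y,z))$; (f2) $f(S^1(x,y),S^1(S^2(x,y),z))=f(y,z)$; (f3) $f(x,s(x))=1$; (f4) $f(x,y)\,f(S^2(x,y),z)=f(x,\tau^1(y,z))\,f(S^2(x,\tau^1(y,z)),\tau^2(y,z))$; (h1) $h(S^1(x,y),S^1(S^2(x,y),z))=h(y,z)$; (c1) $f(x,S^1(y,z))\,h(S^2(x,S^1(y,z)),S^2(y,z))=h(x,y)\,f(\tau^2(x,y),z)$; (c2) $f(y,z)\,h(S^2(x,S^1(y,z)),S^2(y,z))=h(x,y)\,f(\tau^1(x,y),S^1(\tau^2(x,y),z))$; (c3) $h(x,y)=f(x,y)\,h(S(x,y))$; (c4) $h(S(x,y))=h(x,y)\,f(\tau(x,y))$. The group $U_{nc}^{fh}(X,S,\tau)$ is the group generated by symbols $(x,y)_f$ and $(x,y)_h$ for $x,y\in X$, subject to the relations, for all $x,y,z\in X$: - $(x,y)_f\,(S^2(x,y),z)_f=(x,S^1(y,z))_f\,(S^2(x,S^1(y,z)),S^2(y,z))_f$; - $(x,y)_f\,(S^2(x,y),z)_f=(x,\tau^1(y,z))_f\,(S^2(x,\tau^1(y,z)),\tau^2(y,z))_f$; - $(S^1(x,y),S^1(S^2(x,y),z))_h=(y,z)_h$; - $(x,S^1(y,z))_f\,(S^2(x,S^1(y,z)),S^2(y,z))_h=(x,y)_h\,(\tau^2(x,y),z)_f$;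 - $(y,z)_f\,(S^2(x,S^1(y,z)),S^2(y,z))_h=(x,y)_h\,(\tau^1(x,y),S^1(\tau^2(x,y),z))_f$; - $(x,y)_h=(x,y)_f\,(S(x,y))_h$; - $(S(x,y))_h=(x,y)_h\,(\tau(x,y))_f$. The maps $\pi_f,\pi_h:X\times X\to U_{nc}^{fh}$ send $(x,y)$ to the class of $(x,y)_f$ and of $(x,y)_h$, respectively. *)

(* Defs.v *)
From HB Require Import structures.
From mathcomp Require Import all_boot.
From mathcomp Require Import boolp.

Set Implicit Arguments.
Unset Strict Implicit.
Unset Printing Implicit Defensive.

Local Open Scope group_scope.
Local Open Scope quotient_scope.

(* The letter [(a, false)] stands for the generator [a] and [(a, true)] for its
   formal inverse.  Equality and choice on words come from classical logic, so
   the alphabet can be any type. *)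
Definition word (A : Type) : Type := seq (A * bool).

HB.instance Definition _ (A : Type) := gen_eqMixin (word A).
HB.instance Definition _ (A : Type) := gen_choiceMixin (word A).

Definition word_inv (A : Type) (u : word A) : word A :=
  rev [seq (l.1, ~~ l.2) | l <- u].

Section Presentation.
Variables (A : Type) (R : word A -> word A -> Prop).

Inductive pres_cong : word A -> word A -> Prop :=
| pres_refl u : pres_cong u u
| pres_sym u v : pres_cong u v -> pres_cong v u
| pres_trans u v w : pres_cong u v -> pres_cong v w -> pres_cong u w
| pres_cat u u' v v' :
    pres_cong u u' -> pres_cong v v' -> pres_cong (u ++ v) (u' ++ v')
| pres_cancel a b : pres_cong [:: (a, b); (a, ~~ b)] [::]
| pres_rel u v : R u v -> pres_cong u v.

Definition pres_eqb : rel (word A) := fun u v => `[< pres_cong u v >].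

Lemma pres_eqb_refl : reflexive pres_eqb.
Proof. by move=> u; apply/asboolP; apply: pres_refl. Qed.

Lemma pres_eqb_sym : symmetric pres_eqb.
Proof.
by move=> u v; apply/asboolP/asboolP; apply: pres_sym.
Qed.

Lemma pres_eqb_trans : transitive pres_eqb.
Proof.
by move=> v u w /asboolP uv /asboolP vw; apply/asboolP/(pres_trans uv vw).
Qed.

Canonical pres_equiv :=
  EquivRel pres_eqb pres_eqb_refl pres_eqb_sym pres_eqb_trans.

Definition presented : Type := {eq_quot pres_equiv}.

HB.instance Definition _ := Choice.on presented.
HB.instance Definition _ : EqQuotient _ pres_equiv presented :=
  EqQuotient.on presented.

Definition pres_class (u : word A) : presented := \pi_presented u.

Lemma pres_classP u v : pres_class u = pres_class v <-> pres_cong u v.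
Proof.
split=> [/eqP|uv]; first by rewrite /pres_class eqmodE => /asboolP.
by apply/eqP; rewrite /pres_class eqmodE; apply/asboolP.
Qed.

Lemma pres_class_repr c : pres_class (repr c) = c.
Proof. exact: reprK. Qed.

Lemma pres_repr_class u : pres_cong (repr (pres_class u)) u.
Proof. by apply/pres_classP; rewrite pres_class_repr. Qed.

Lemma word_invK : involutive (@word_inv A).
Proof.
move=> u; rewrite /word_inv map_rev revK -map_comp.
by rewrite (@eq_map _ _ _ id) ?map_id // => -[a b] /=; rewrite negbK.
Qed.

Lemma pres_cong_mulV u : pres_cong (word_inv u ++ u) [::].
Proof.
elim: u => [|[a b] u IHu]; first exact: pres_refl.
rewrite /word_inv /= rev_cons -cats1 -catA /= -/(word_inv u).
apply: pres_trans IHu; apply: pres_cat (pres_refl _) _.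
rewrite -[X in pres_cong _ X]cat0s -[(_, _) :: (_, _) :: u]/([:: _; _] ++ u).
apply: pres_cat (pres_refl _).
by have := pres_cancel a (~~ b); rewrite negbK.
Qed.

Lemma pres_cong_Vmul u : pres_cong (u ++ word_inv u) [::].
Proof. by have := pres_cong_mulV (word_inv u); rewrite word_invK. Qed.

Lemma pres_cong_inv u v :
  pres_cong u v -> pres_cong (word_inv u) (word_inv v).
Proof.
move=> uv; rewrite -[word_inv u]cats0 -[word_inv v]cat0s.
apply: pres_trans (pres_cat (pres_refl _) (pres_sym (pres_cong_Vmul v))) _.
rewrite catA; apply: pres_cat (pres_refl _).
exact: pres_trans (pres_cat (pres_refl _) (pres_sym uv)) (pres_cong_mulV u).
Qed.

Definition pres_one : presented := pres_class [::].
Definition pres_mul (c d : presented) : presented :=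
  pres_class (repr c ++ repr d).
Definition pres_inv (c : presented) : presented :=
  pres_class (word_inv (repr c)).

Lemma pres_mulE u v :
  pres_mul (pres_class u) (pres_class v) = pres_class (u ++ v).
Proof. by apply/pres_classP/pres_cat; apply: pres_repr_class. Qed.

Lemma pres_invE u : pres_inv (pres_class u) = pres_class (word_inv u).
Proof. by apply/pres_classP/pres_cong_inv/pres_repr_class. Qed.

Lemma pres_mulA : associative pres_mul.
Proof.
move=> c d e; rewrite -(pres_class_repr c) -(pres_class_repr d).
by rewrite -(pres_class_repr e) !pres_mulE catA.
Qed.

Lemma pres_mul1 : left_id pres_one pres_mul.
Proof. by move=> c; rewrite -(pres_class_repr c) pres_mulE cat0s. Qed.

Lemma pres_mulr1 : right_id pres_one pres_mul.
Proof. by move=> c; rewrite -(pres_class_repr c) pres_mulE cats0. Qed.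

Lemma pres_mulV : left_inverse pres_one pres_inv pres_mul.
Proof.
move=> c; rewrite -(pres_class_repr c) pres_invE pres_mulE.
exact/pres_classP/pres_cong_mulV.
Qed.

Lemma pres_Vmul : right_inverse pres_one pres_inv pres_mul.
Proof.
move=> c; rewrite -(pres_class_repr c) pres_invE pres_mulE.
exact/pres_classP/pres_cong_Vmul.
Qed.

HB.instance Definition _ :=
  isGroup.Build presented pres_mulA pres_mul1 pres_mulr1 pres_mulV pres_Vmul.

End Presentation.

Section SingularPairs.
Variable X : Type.
Implicit Types (S T tau : X * X -> X * X) (s : X -> X).

Definition left_invertible T : Prop :=
  forall x z, exists! y, (T (x, y)).1 = z.

Definition right_invertible T : Prop :=
  forall y w, exists! x, (T (x, y)).2 = w.

(* The maps T x Id and Id x T. *)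
Definition op12 T : X * X * X -> X * X * X :=
  fun '(x, y, z) => ((T (x, y)).1, (T (x, y)).2, z).

Definition op23 T : X * X * X -> X * X * X :=
  fun '(x, y, z) => (x, (T (y, z)).1, (T (y, z)).2).

Definition fixpoint_bijection S s : Prop :=
  bijective s /\ forall p, S p = p <-> exists x, p = (x, s x).

Record biquandle S : Prop := {
  biquandle_bij : bijective S;
  biquandle_left : left_invertible S;
  biquandle_right : right_invertible S;
  biquandle_yb : op23 S \o op12 S \o op23 S = op12 S \o op23 S \o op12 S;
  biquandle_fix : exists s, fixpoint_bijection S s
}.

Record singular_pair S tau : Prop := {
  singular_biquandle : biquandle S;
  singular_bij : bijective tau;
  singular_left : left_invertible tau;
  singular_right : right_invertible tau;
  singular_comm : tau \o S = S \o tau;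
  singular_yb12 : op12 S \o op23 S \o op12 tau = op23 tau \o op12 S \o op23 S;
  singular_yb23 : op23 S \o op12 S \o op23 tau = op12 tau \o op23 S \o op12 S
}.

End SingularPairs.

Section CocyclePairs.
Variables (X : Type) (S tau : X * X -> X * X) (s : X -> X).

Local Notation S1 a b := (S (a, b)).1.
Local Notation S2 a b := (S (a, b)).2.
Local Notation t1 a b := (tau (a, b)).1.
Local Notation t2 a b := (tau (a, b)).2.

(* [s] is uniquely determined by [S] through [fixpoint_bijection]. *)
Record nc_cocycle_pair (H : groupType) (f h : X * X -> H) : Prop := {
  cocycle_f1 x y z :
    f (x, y) * f (S2 x y, z) = f (x, S1 y z) * f (S2 x (S1 y z), S2 y z);
  cocycle_f2 x y z : f (S1 x y, S1 (S2 x y) z) = f (y, z);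
  cocycle_f3 x : f (x, s x) = 1;
  cocycle_f4 x y z :
    f (x, y) * f (S2 x y, z) = f (x, t1 y z) * f (S2 x (t1 y z), t2 y z);
  cocycle_h1 x y z : h (S1 x y, S1 (S2 x y) z) = h (y, z);
  cocycle_c1 x y z :
    f (x, S1 y z) * h (S2 x (S1 y z), S2 y z) = h (x, y) * f (t2 x y, z);
  cocycle_c2 x y z :
    f (y, z) * h (S2 x (S1 y z), S2 y z)
      = h (x, y) * f (t1 x y, S1 (t2 x y) z);
  cocycle_c3 x y : h (x, y) = f (x, y) * h (S (x, y));
  cocycle_c4 x y : h (S (x, y)) = h (x, y) * f (tau (x, y))
}.

End CocyclePairs.

Inductive fh_gen (X : Type) := Fgen of X * X | Hgen of X * X.

Section UniversalGroup.
Variables (X : Type) (S tau : X * X -> X * X).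

Local Notation S1 a b := (S (a, b)).1.
Local Notation S2 a b := (S (a, b)).2.
Local Notation t1 a b := (tau (a, b)).1.
Local Notation t2 a b := (tau (a, b)).2.
Local Notation F p := (Fgen p, false).
Local Notation G p := (Hgen p, false).

Inductive fh_rel : word (fh_gen X) -> word (fh_gen X) -> Prop :=
| fh_f1 x y z :
    fh_rel [:: F (x, y); F (S2 x y, z)]
           [:: F (x, S1 y z); F (S2 x (S1 y z), S2 y z)]
| fh_f4 x y z :
    fh_rel [:: F (x, y); F (S2 x y, z)]
           [:: F (x, t1 y z); F (S2 x (t1 y z), t2 y z)]
| fh_h1 x y z :
    fh_rel [:: G (S1 x y, S1 (S2 x y) z)] [:: G (y, z)]
| fh_c1 x y z :
    fh_rel [:: F (x, S1 y z); G (S2 x (S1 y z), S2 y z)]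
           [:: G (x, y); F (t2 x y, z)]
| fh_c2 x y z :
    fh_rel [:: F (y, z); G (S2 x (S1 y z), S2 y z)]
           [:: G (x, y); F (t1 x y, S1 (t2 x y) z)]
| fh_c3 x y :
    fh_rel [:: G (x, y)] [:: F (x, y); G (S (x, y))]
| fh_c4 x y :
    fh_rel [:: G (S (x, y))] [:: G (x, y); F (tau (x, y))].

Definition Unc_fh : groupType := presented fh_rel.

Definition pi_f (p : X * X) : Unc_fh := pres_class fh_rel [:: (Fgen p, false)].
Definition pi_h (p : X * X) : Unc_fh := pres_class fh_rel [:: (Hgen p, false)].

End UniversalGroup.

(* Main.v *)
Require Import Defs.
From HB Require Import structures.
From mathcomp Require Import all_boot.
From mathcomp Require Import boolp.

(** Most of the cocycle equations are defining relations of the universal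
    group, so two points carry the theorem.

    The equations f2 and f3 are not among the relations, and both follow from
    c3, which expresses f through h: f(p) = h(p) h(S p)^-1.  If S fixes p, this
    gives f(p) = 1, and that is f3 since the points (x, s x) are fixed.  For f2,
    let x act on a pair (y, z) by carrying the strand x across the strands y and
    z ([strand_across]).  Then h1 says that h is invariant under this action,
    and the Yang-Baxter equation says that the action commutes with S
    ([strand_acrossS]).  So h o S is invariant too, and with it f
    ([twist_strand_across]).

    The universal property is that of a group given by generators and relations
    ([presented_lift], [presented_hom_eq]), once the cocycle equations of (f, h)
    are read as the relations holding among the images f(p) and h(p) of the
    generators. *)

Set Implicit Arguments.
Unset Strict Implicit.
Unset Printing Implicit Defensive.

Lemma umagma_morphism_eq (G H : baseUMagmaType)
    (rho sigma : UMagmaMorphism.type G H) :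
  rho =1 sigma -> rho = sigma.
Proof.
move=> /funext; case: rho sigma => f [[f1] [fM]] [f' [[f1'] [fM']]] /= ff'.
case: f' / ff' f1' fM' => f1' fM'.
by rewrite (Prop_irrelevance f1 f1') (Prop_irrelevance fM fM').
Qed.

Section PresentedGroup.
Local Open Scope group_scope.
Variables (A : Type) (R : word A -> word A -> Prop) (H : groupType).
Implicit Types (g : A -> H) (u v : word A) (rho : presented R -> H).

Lemma pres_classM u v :
  pres_class R u * pres_class R v = pres_class R (u ++ v).
Proof. exact: pres_mulE. Qed.

Lemma pres_class_rel u v : R u v -> pres_class R u = pres_class R v.
Proof. by move=> Ruv; apply/pres_classP/pres_rel. Qed.

Definition letter_eval g (l : A * bool) : H := if l.2 then (g l.1)^-1 else g l.1.
Definition word_eval g u : H := \prod_(l <- u) letter_eval g l.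

Lemma word_eval_cat g u v : word_eval g (u ++ v) = word_eval g u * word_eval g v.
Proof. exact: big_cat. Qed.

Lemma word_eval_cong g u v :
    (forall u' v', R u' v' -> word_eval g u' = word_eval g v') ->
  pres_cong R u v -> word_eval g u = word_eval g v.
Proof.
move=> gR; elim=> {u v} //.
- by move=> u v w _ -> _ ->.
- by move=> u u' v v' _ Eu _ Ev; rewrite !word_eval_cat Eu Ev.
- move=> a b; rewrite /word_eval !big_cons !big_nil mulg1 /letter_eval /=.
  by case: b => /=; rewrite ?mulVg ?mulgV.
Qed.

(** The homomorphism evaluates a chosen representative of each class; it is
    multiplicative because evaluation does not depend on that choice. *)
Lemma presented_lift g :
    (forall u v, R u v -> word_eval g u = word_eval g v) ->
  exists rho : UMagmaMorphism.type (presented R) H,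
    forall a, rho (pres_class R [:: (a, false)]) = g a.
Proof.
move=> gR; pose ev (c : presented R) : H := word_eval g (repr c).
have evE u : ev (pres_class R u) = word_eval g u.
  exact: word_eval_cong gR (pres_repr_class R u).
have evM : {morph ev : c d / c * d}.
  move=> c d; rewrite -(pres_class_repr c) -(pres_class_repr d) pres_classM.
  by rewrite !evE word_eval_cat.
have ev1 : ev 1 = 1 by rewrite [LHS]evE /word_eval big_nil.
pose evU := isUMagmaMorphism.Build (presented R) H ev (conj ev1 evM).
pose rho : UMagmaMorphism.type (presented R) H := HB.pack ev evU.
by exists rho => a; rewrite [LHS]evE /word_eval big_cons big_nil mulg1.
Qed.

Lemma presented_hom_eq (rho sigma : UMagmaMorphism.type (presented R) H) :
    (forall a, rho (pres_class R [:: (a, false)])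
                 = sigma (pres_class R [:: (a, false)])) ->
  rho = sigma.
Proof.
move=> Egen; apply: umagma_morphism_eq => c; rewrite -(pres_class_repr c).
elim: (repr c) => [|[a b] u IHu]; first by rewrite [LHS]gmulf1 [RHS]gmulf1.
rewrite -cat1s -pres_classM !gmulfM {}IHu; congr (_ * _).
case: b; last exact: Egen.
have -> : pres_class R [:: (a, true)] = (pres_class R [:: (a, false)])^-1.
  by rewrite [RHS]pres_invE.
by rewrite !gmulfV Egen.
Qed.

End PresentedGroup.

Section Twist.
Local Open Scope group_scope.
Variables (X : Type) (S : X * X -> X * X) (H : groupType) (f h : X * X -> H).

Definition strand_across (x : X) (p : X * X) : X * X :=
  ((S (x, p.1)).1, (S ((S (x, p.1)).2, p.2)).1).

(** These are the first two components of the Yang-Baxter equation. *)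
Lemma strand_acrossS x p :
    op23 S \o op12 S \o op23 S = op12 S \o op23 S \o op12 S ->
  S (strand_across x p) = strand_across x (S p).
Proof.
case: p => y z /(congr1 (fun F => F (x, y, z))) /= [E1 E2 _].
by rewrite /strand_across /= E1 E2 -surjective_pairing.
Qed.

Hypothesis hE : forall p, h p = f p * h (S p).

Lemma twist_fixed p : S p = p -> f p = 1.
Proof. by move=> Sp; apply: (@mulIg _ (h p)); rewrite mul1g [RHS]hE Sp. Qed.

(** f is a quotient of h and h o S, and both are invariant: the second because
    S commutes with the action of x. *)
Lemma twist_strand_across :
    op23 S \o op12 S \o op23 S = op12 S \o op23 S \o op12 S ->
    (forall x p, h (strand_across x p) = h p) ->
  forall x p, f (strand_across x p) = f p.
Proof.
move=> yb h_across x p; apply: (@mulIg _ (h (S p))).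
by rewrite -hE -(h_across x (S p)) -strand_acrossS // -hE h_across.
Qed.

End Twist.

Section Universal.
Local Open Scope group_scope.
Variables (X : Type) (S tau : X * X -> X * X) (s : X -> X).

Lemma pi_cocycle_pair :
    op23 S \o op12 S \o op23 S = op12 S \o op23 S \o op12 S ->
    (forall x, S (x, s x) = (x, s x)) ->
  nc_cocycle_pair S tau s (pi_f S tau) (pi_h S tau).
Proof.
move=> yb Ss.
have h1 x p : pi_h S tau (strand_across S x p) = pi_h S tau p.
  by case: p => y z; apply: pres_class_rel; apply: fh_h1.
have c3 p : pi_h S tau p = pi_f S tau p * pi_h S tau (S p).
  by case: p => x y; rewrite pres_classM; apply: pres_class_rel; apply: fh_c3.
split=> *; rewrite ?pres_classM.
- by apply: pres_class_rel; apply: fh_f1.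
- exact: (twist_strand_across c3 yb h1 _ (_, _)).
- exact: (twist_fixed (H := Unc_fh S tau) c3 (Ss _)).
- by apply: pres_class_rel; apply: fh_f4.
- exact: (h1 _ (_, _)).
- by apply: pres_class_rel; apply: fh_c1.
- by apply: pres_class_rel; apply: fh_c2.
- by apply: pres_class_rel; apply: fh_c3.
- by apply: pres_class_rel; apply: fh_c4.
Qed.

Definition fh_value (H : Type) (f h : X * X -> H) (a : fh_gen X) : H :=
  match a with Fgen p => f p | Hgen p => h p end.

Lemma fh_value_rel (H : groupType) (f h : X * X -> H) u v :
    nc_cocycle_pair S tau s f h -> fh_rel S tau u v ->
  word_eval (fh_value f h) u = word_eval (fh_value f h) v.
Proof.
case=> f1 _ _ f4 h1 c1 c2 c3 c4.
by case=> *; rewrite /word_eval !big_cons !big_nil !mulg1 /letter_eval /=.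
Qed.

End Universal.

Theorem theorem31 (X : Type) (S tau : X * X -> X * X) (s : X -> X)
    (hST : singular_pair S tau) (hs : fixpoint_bijection S s) :
  nc_cocycle_pair S tau s (pi_f S tau) (pi_h S tau) /\
  (forall (H : groupType) (f h : X * X -> H),
     nc_cocycle_pair S tau s f h ->
     exists! rho : UMagmaMorphism.type (Unc_fh S tau) H,
       f = rho \o pi_f S tau /\ h = rho \o pi_h S tau).
Proof.
split.
  apply: pi_cocycle_pair (biquandle_yb (singular_biquandle hST)) _ => x.
  by apply/(proj2 hs); exists x.
move=> H f h fh.
have [rho rhoE] := presented_lift (fun u v => @fh_value_rel _ _ _ _ _ _ _ u v fh).
exists rho; split; first by split; apply/funext => p; rewrite /= [RHS]rhoE.
move=> sigma [fE hE]; apply: presented_hom_eq => a; rewrite rhoE.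
by case: a => p /=; rewrite ?fE ?hE.
Qed.
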